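(* Let $0<y<\frac12$ be such that $y$ is not a dyadic rational, and write its binary expansion as $y=\sum_{n=1}^\infty 2^{-n}\omega_n$ with $\omega_n\in\{0,1\}$. Suppose there do not exist indices $k<l$ such that $\omega_k=1$ and $\omega_l=\omega_{l+1}=\omega_{l+2}=0$ (that is, the binary expansion of $y$ does not contain three consecutive $0$'s anywhere after the occurrence of its first $1$). Then $|L(y)|=2$.
   Context: Let $\phi(x)=\operatorname{dist}(x,\mathbb{Z})$; the Takagi function is $T(x)=\sum_{n=0}^\infty 2^{-n}\phi(2^nx)$, and $L(y)=\{x\in[0,1]:T(x)=y\}$. $|\cdot|$ denotes cardinality. *)

(* Defs.v *)
From HB Require Import structures.
From mathcomp Require Import all_boot all_order all_algebra.
From mathcomp Require Import all_classical all_reals all_analysis.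
Set Implicit Arguments.
Unset Strict Implicit.
Unset Printing Implicit Defensive.
Import Order.TTheory GRing.Theory Num.Theory.
Import numFieldNormedType.Exports.
Local Open Scope classical_set_scope.
Local Open Scope ring_scope.

Definition dist_int (R : realType) (x : R) : R :=
  inf [set `|x - k%:~R| | k in [set: int]].

(* limn is a total limit operator; the series converges for every x because
   its general term is nonnegative and at most 2^-n / 2. *)
Definition takagi (R : realType) (x : R) : R :=
  limn (series (fun n : nat => 2 ^- n * dist_int (2 ^+ n * x))).

Definition level_set (R : realType) (y : R) : set R :=
  [set x | 0 <= x <= 1 /\ takagi x = y].

Definition dyadic_rational (R : realType) (y : R) : Prop :=
  exists (m : int) (n : nat), y = m%:~R / 2 ^+ n.

(* The digits are indexed from 1; the value w 0 is ignored. *)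
Definition binary_expansion (R : realType) (y : R) (w : nat -> bool) : Prop :=
  \sum_(1 <= n < N) 2 ^- n * (w n)%:R @[N --> \oo] --> y.

(* Main.v *)
Require Import Defs.
From HB Require Import structures.
From mathcomp Require Import all_boot all_order all_algebra.
From mathcomp Require Import all_classical all_reals all_analysis.
From mathcomp Require Import ring lra zify.
Set Implicit Arguments.
Unset Strict Implicit.
Unset Printing Implicit Defensive.
Import Order.TTheory GRing.Theory Num.Theory.
Import numFieldNormedType.Exports.
Local Open Scope classical_set_scope.
Local Open Scope ring_scope.

(* Halving the interval turns T(u) + c u = z on [0, 1] into an equation of the
   same shape: T(2u) + (c+1)(2u) = 2z on the left half, and
   T(2u-1) + (c-1)(2u-1) = 2z - (c+1) on the right half.  Since T >= 0 the right
   half needs 2z >= c+1, and since T(x) + (c+1)x <= (c+1) + 2^-(c+1) on [0, 1]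
   the left half needs 2z <= (c+1) + 2^-(c+1).  When both are possible, c >= 2
   and the fractional part of some 2^n y > 1 is at most 1/8, which the absence
   of 000 forbids.  So each binary digit of a solution x < 1/2 is forced, the
   forced digits do define a solution, and x |-> 1 - x gives the other one. *)

(** * Distance to the nearest integer *)

Lemma dist_int_le (R : realType) (x : R) (k : int) :
  dist_int x <= `|x - k%:~R|.
Proof. by apply: ge_inf; [exists 0 => _ [j _ <-] | exists k]. Qed.

Lemma dist_int_ge (R : realType) (x a : R) :
  (forall k : int, a <= `|x - k%:~R|) -> a <= dist_int x.
Proof.
move=> ax; apply: lb_le_inf; first by exists `|x - 0%:~R|, 0.
by move=> _ [k _ <-].
Qed.

Lemma dist_int_ge0 (R : realType) (x : R) : 0 <= dist_int x.
Proof. exact: dist_int_ge. Qed.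

Lemma dist_int_le_half (R : realType) (x : R) : dist_int x <= 1 / 2.
Proof.
have /andP[fx xf] := floor_itv x; rewrite intrD in xf.
have [lo|hi] := leP (x - (Num.floor x)%:~R) (1 / 2).
  by apply: (le_trans (dist_int_le x (Num.floor x))); rewrite ger0_norm; lra.
apply: (le_trans (dist_int_le x (Num.floor x + 1))).
by rewrite intrD ler0_norm; lra.
Qed.

Lemma dist_intD (R : realType) (x : R) (k : int) :
  dist_int (x + k%:~R) = dist_int x.
Proof.
have le z j : dist_int (z + j%:~R) <= dist_int z :> R.
  apply: dist_int_ge => i; have := dist_int_le (z + j%:~R) (i + j).
  by rewrite intrD; congr (_ <= `|_|); ring.
apply/le_anti; rewrite le /=.
by have := le (x + k%:~R) (- k); rewrite intrN addrK.
Qed.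

Lemma dist_intN (R : realType) (x : R) : dist_int (- x) = dist_int x.
Proof.
have le z : dist_int (- z) <= dist_int z :> R.
  apply: dist_int_ge => i; have := dist_int_le (- z) (- i).
  by rewrite intrN -opprD normrN.
by apply/le_anti; rewrite le /= -{1}[x]opprK le.
Qed.

Lemma dist_int_id (R : realType) (x : R) : 0 <= x <= 1 / 2 -> dist_int x = x.
Proof.
move=> /andP[x0 x1]; apply/le_anti/andP; split.
  by apply: (le_trans (dist_int_le x 0)); rewrite subr0 ger0_norm.
apply: dist_int_ge => k; have [k0|k1] := leP k 0.
  have kR : k%:~R <= 0 :> R by rewrite lerz0.
  by rewrite ger0_norm; lra.
have kR : 1 <= k%:~R :> R by rewrite ler1z; lia.
by rewrite ler0_norm; lra.
Qed.

(** * The Takagi function: functional equations and bounds *)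

Section Takagi.
Variable R : realType.
Implicit Types (x : R) (n c : nat).

Let term x n : R := 2 ^- n * dist_int (2 ^+ n * x).

Let pow2_gt0 n : 0 < 2 ^- n :> R.
Proof. by rewrite invr_gt0 exprn_gt0. Qed.

Let term_ge0 x n : 0 <= term x n.
Proof. by rewrite mulr_ge0 ?dist_int_ge0 // ltW. Qed.

Let nondecreasing_term x : nondecreasing_seq (series (term x)).
Proof.
apply/nondecreasing_seqP => n; rewrite /series /= big_nat_recr //=.
by rewrite lerDl.
Qed.

Let series_term_le1 x n : series (term x) n <= 1.
Proof.
(* The explicit remainder [2 ^- n] lets the induction close. *)
suff : series (term x) n <= 1 - 2 ^- n by have := pow2_gt0 n; lra.
elim: n => [|n IH]; first by rewrite /series /= big_geq // expr0 invr1 subrr.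
rewrite /series /= in IH *; rewrite big_nat_recr //=.
have : term x n <= 2 ^- n * (1 / 2).
  by rewrite ler_wpM2l ?dist_int_le_half // ltW.
have -> : 2 ^- n.+1 = 2 ^- n * (1 / 2) :> R.
  by rewrite exprS invfM; field; rewrite expf_neq0.
lra.
Qed.

Let is_cvg_term x : cvgn (series (term x)).
Proof.
apply: nondecreasing_is_cvgn => //.
by exists 1 => _ [n _ <-]; exact: series_term_le1.
Qed.

Lemma takagi_ge0 x : 0 <= takagi x.
Proof.
apply: (limr_ge (@is_cvg_term x)).
by apply: nearW => n; apply: sumr_ge0.
Qed.

Lemma takagi_le1 x : takagi x <= 1.
Proof.
apply: (limr_le (@is_cvg_term x)).
by apply: nearW => n; exact: series_term_le1.
Qed.

Lemma takagi_ext x1 x2 :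
  (forall n, dist_int (2 ^+ n * x1) = dist_int (2 ^+ n * x2)) ->
  takagi x1 = takagi x2.
Proof.
by move=> e; rewrite /takagi; congr (limn (series _)); apply/funext => n; rewrite e.
Qed.

Lemma takagi_add1 x : takagi (x + 1) = takagi x.
Proof.
apply: takagi_ext => n; rewrite mulrDr mulr1.
by have := dist_intD (2 ^+ n * x) (2 ^+ n); rewrite rmorphXn.
Qed.

Lemma takagi_refl x : takagi (1 - x) = takagi x.
Proof.
rewrite addrC takagi_add1; apply: takagi_ext => n.
by rewrite mulrN dist_intN.
Qed.

(** Splitting off the term of index 0 leaves half of the series at [2 * x]. *)
Lemma takagi_double x : takagi x = dist_int x + takagi (2 * x) / 2.
Proof.
apply: (@cvg_lim _ (@Rhausdorff R)).
rewrite -(cvg_shiftS (series (term x))).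
have -> : [sequence series (term x) n.+1]_n =
    (fun n => dist_int x + series (term (2 * x)) n / 2).
  apply/funext => n /=; rewrite /series /= big_nat_recl // {1}/term expr0 invr1.
  rewrite !mul1r mulr_suml; congr (_ + _); apply: eq_bigr => i _.
  by rewrite /term mulrA -exprSr exprS invfM; ring.
by apply: cvgD; [exact: cvg_cst | apply: cvgMl; exact: is_cvg_term].
Qed.

Lemma takagi_lhalf x : 0 <= x <= 1 / 2 -> takagi x = x + takagi (2 * x) / 2.
Proof. by move=> h; rewrite takagi_double dist_int_id. Qed.

Lemma takagi_rhalf x :
  1 / 2 <= x <= 1 -> takagi x = 1 - x + takagi (2 * x - 1) / 2.
Proof.
move=> h; rewrite -(takagi_refl x) takagi_lhalf; last by lra.
by rewrite -(takagi_refl (2 * x - 1)); congr (_ + takagi _ / 2); ring.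
Qed.

(* The slack 2^-c is what makes the inequality reproduce itself under
   x |-> 2x - 1 on the right half; the left half only needs T <= 1. *)
Lemma takagi_le_line c x : (0 < c)%N -> 0 <= x <= 1 ->
  takagi x + c%:R * x <= c%:R + 2 ^- c.
Proof.
elim: c x => [//|c IH] x _ x01; rewrite exprS invfM.
have c0 : 0 <= c%:R :> R by [].
have e0 := pow2_gt0 c; have T1 := takagi_le1.
have [xl|xr] := leP x (1 / 2).
  case: (posnP c) => [->|cp]; first by rewrite expr0 invr1; have := T1 x; lra.
  have c1 : 1 <= c%:R :> R by rewrite ler1n.
  have := T1 x; have : c.+1%:R * x <= (c.+1%:R : R) * (1 / 2) by rewrite ler_wpM2l.
  by rewrite -[c.+1%:R]natr1; lra.
have x'01 : 0 <= 2 * x - 1 <= 1 by lra.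
rewrite takagi_rhalf; last by lra.
(* Slope 1 is the base case: T(x) + x = 1 + T(2x - 1)/2 <= 3/2. *)
case: (posnP c) => [->|cp].
  by rewrite expr0 invr1; have := T1 (2 * x - 1); lra.
by have := IH _ cp x'01; rewrite -[c.+1%:R]natr1; lra.
Qed.

End Takagi.

(** * Binary expansions and their tails under doubling *)

Section BinaryExpansion.
Variable R : realType.
Implicit Types (w : nat -> bool) (y : R).

Let digit_sum w N : R := \sum_(1 <= n < N) 2 ^- n * (w n)%:R.

Let pow2S n : 2 ^- n = 2 * 2 ^- n.+1 :> R.
Proof. by rewrite exprS invfM mulrA divff ?mul1r. Qed.

Let pow2_gt0 n : 0 < 2 ^- n :> R.
Proof. by rewrite invr_gt0 exprn_gt0. Qed.

Let digit_sumS w n :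
  digit_sum w n.+2 = digit_sum w n.+1 + 2 ^- n.+1 * (w n.+1)%:R.
Proof. by rewrite /digit_sum big_nat_recr. Qed.

(** Digits n + 1, ..., n + m add at most the geometric sum 2^-n - 2^-(n + m). *)
Let digit_sum_bounds w n m :
  digit_sum w n.+1 <= digit_sum w (n + m).+1 <=
    digit_sum w n.+1 + 2 ^- n - 2 ^- (n + m).
Proof.
elim: m => [|m]; first by rewrite addn0 addrK lexx.
rewrite addnS digit_sumS [2 ^- (n + m)]pow2S => /andP[lo hi].
have := pow2_gt0 (n + m).+1.
by case: (w _) => /=; lra.
Qed.

Lemma binary_expansion_exists w : exists y, binary_expansion y w.
Proof.
suff /cvg_ex[y cy] : cvgn (fun n => digit_sum w n.+1).
  by exists y; rewrite /binary_expansion -cvg_shiftS.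
apply: nondecreasing_is_cvgn.
  apply/nondecreasing_seqP => n /=.
  by have := digit_sum_bounds w n 1; rewrite addn1 => /andP[].
exists 1 => _ [n _ <-] /=; have := digit_sum_bounds w 0 n.
have -> : digit_sum w 1 = 0 by rewrite /digit_sum big_geq.
rewrite expr0 invr1 !add0r add0n => /andP[_].
by have := pow2_gt0 n; lra.
Qed.

(** [t n] is the value of the digits after position n; it may equal 1, since [w] may end in ones. *)
Lemma binary_expansion_tails y w : binary_expansion y w ->
  exists t : nat -> R, [/\ t 0%N = y, forall n, 0 <= t n <= 1
    & forall n, t n.+1 = 2 * t n - (w n.+1)%:R].
Proof.
move=> yw; have yw' : digit_sum w n.+1 @[n --> \oo] --> y by rewrite cvg_shiftS.
exists (fun n => 2 ^+ n * (y - digit_sum w n.+1)); split => [|n|n].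
- by rewrite /digit_sum big_geq // expr0 mul1r subr0.
- have p0 : 0 < 2 ^+ n :> R by rewrite exprn_gt0.
  have : digit_sum w n.+1 <= y <= digit_sum w n.+1 + 2 ^- n.
    have near_bounds : \forall N \near \oo,
        digit_sum w n.+1 <= digit_sum w N.+1 <= digit_sum w n.+1 + 2 ^- n.
      exists n => // N /= nN; have := digit_sum_bounds w n (N - n).
      by rewrite subnKC //; have := pow2_gt0 N; lra.
    apply/andP; split.
      by apply: (cvgr_to_ge yw'); apply: filterS near_bounds => N /andP[].
    by apply: (cvgr_to_le yw'); apply: filterS near_bounds => N /andP[].
  move=> /andP[lo hi]; apply/andP; split; first by rewrite mulr_ge0 ?subr_ge0 // ltW.
  rewrite -[leRHS](@divff _ (2 ^+ n)) ?gt_eqF // ler_pM2l //; lra.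
- rewrite digit_sumS exprS; field.
  by rewrite ?expf_neq0.
Qed.

Lemma ndyadic_neq y : ~ dyadic_rational y ->
  forall (n : nat) (m : int), 2 ^+ n * y <> m%:~R.
Proof.
move=> yd n m e; apply: yd; exists m, n.
by rewrite -e mulrC mulKf ?expf_neq0.
Qed.

(** A positive integer part of 2^n y puts a 1 among the first n digits; for non-dyadic y, a
    fractional part of at most 1/8 makes the next three digits 0. *)
Lemma ndyadic_frac_gt8 y w (n m : nat) :
  ~ dyadic_rational y -> binary_expansion y w ->
  ~ (exists k l : nat,
     [/\ (1 <= k)%N, (k < l)%N, w k = true
       & [/\ w l = false, w l.+1 = false & w l.+2 = false]]) ->
  (0 < m)%N -> m%:R <= 2 ^+ n * y -> m%:R + 1 / 8 < 2 ^+ n * y.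
Proof.
move=> yd yw w000 m0 my; rewrite ltNge; apply/negP => ym.
have [t [t0 t01 tS]] := binary_expansion_tails yw.
(* d is the integer formed by the first n digits, so it is positive only after a 1. *)
have [d [td dw]] : exists d : nat, t n = 2 ^+ n * y - d%:R /\
    ((0 < d)%N -> exists k, [/\ (1 <= k)%N, (k <= n)%N & w k]).
  elim: (n) => [|j [d [td dw]]].
    by exists 0%N; split=> //; rewrite t0 expr0 mul1r subr0.
  exists (2 * d + w j.+1)%N; split.
    by rewrite tS td exprS natrD natrM; ring.
  case wj : (w j.+1); first by move=> _; exists j.+1.
  rewrite addn0 muln_gt0 => /dw[k [k1 kj wk]]; exists k; split=> //.
  exact: leqW.
have yn := ndyadic_neq yd.
have /andP[tn0 tn1] := t01 n.
have tn1' : t n < 1.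
  rewrite lt_neqAle tn1 andbT; apply/eqP => e; apply: (yn n d.+1).
  by rewrite -pmulrn -natr1; lra.
have md : m = d.
  by apply/eqP; rewrite eqn_leq -[(m <= d)%N]ltnS -[(d <= m)%N]ltnS
    -!(ltr_nat R) -[m.+1%:R]natr1 -[d.+1%:R]natr1; apply/andP; split; lra.
subst d; have [k [k1 kn wk]] := dw m0.
have t8 : t n < 1 / 8.
  rewrite lt_neqAle; apply/andP; split; last by lra.
  (* Equality would give 2^(n+3) y = 8m + 1, making y dyadic. *)
  apply/eqP => e; apply: (yn (3 + n)%N (8 * m + 1)%N).
  by rewrite exprD -pmulrn natrD natrM; lra.
(* Starting below 1/8, the next tails stay below 1/4, 1/2 and 1; a digit 1 would make one of them
   negative. *)
apply: w000; exists k, n.+1; split=> //.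
have /andP[a1 _] := t01 n.+1; have /andP[a2 _] := t01 n.+2.
have /andP[a3 _] := t01 n.+3.
have e1 := tS n; have e2 := tS n.+1; have e3 := tS n.+2.
have w1 : w n.+1 = false by apply/negP => W; rewrite W /= in e1; lra.
rewrite w1 /= in e1.
have w2 : w n.+2 = false by apply/negP => W; rewrite W /= in e2; lra.
rewrite w2 /= in e2.
by split=> //; apply/negP => W; rewrite W /= in e3; lra.
Qed.

End BinaryExpansion.

(** * Doubling dynamics of the equation T(u) + c u = z *)

Lemma pow2_scaled_small_eq0 (R : realType) (a : R) :
  (forall n : nat, 2 ^+ n * `|a| <= n.+2%:R) -> a = 0.
Proof.
move=> small; apply/eqP/negPn/negP => an0.
have a0 : 0 < `|a| by rewrite normr_gt0.
have [m ma] : exists m : nat, 2 / `|a| < m%:R.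
  by exists (Num.bound (2 / `|a|)); apply: archi_boundP; rewrite divr_ge0.
(* Since m |a| > 2, the choice n = 2m gives 4^m |a| >= (m+1)^2 |a| > 2(m+1) = n + 2. *)
have := small (2 * m)%N; rewrite mulnC exprM.
have : m.+1%:R <= 2 ^+ m :> R by rewrite -natrX ler_nat ltn_expl.
rewrite ltr_pdivrMr // in ma.
have -> : (m * 2).+2%:R = 2 * m.+1%:R :> R by rewrite -natrM; congr _%:R; lia.
have : m%:R < m.+1%:R :> R by rewrite ltr_nat.
have : 0 <= m%:R :> R by [].
move: (2 ^+ m) (m.+1%:R) => p q; rewrite expr2; nra.
Qed.

(* A state (c, z) stands for the equation T(u) + c u = z on [0, 1]. *)
Definition takagi_step (R : realType) (s : nat * R) : nat * R :=
  if 2 * s.2 < s.1.+1%:R then (s.1.+1, 2 * s.2)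
  else (s.1.-1, 2 * s.2 - s.1.+1%:R).

(** The start (1, 2y) encodes T(x) = y on the left half: with u = 2x it reads T(u) + u = 2y. *)
Definition takagi_state (R : realType) (y : R) (n : nat) : nat * R :=
  iter n (@takagi_step R) (1%N, 2 * y).

Definition takagi_digit (R : realType) (s : nat * R) : bool :=
  s.1.+1%:R <= 2 * s.2.

Definition takagi_gap (R : realType) (s : nat * R) (u : R) : R :=
  takagi u + s.1%:R * u - s.2.

(** The range conditions place u in the half chosen by the digit, where the functional equation of T
    doubles the residual. *)
Lemma takagi_gap_step (R : realType) (s : nat * R) (u : R) :
  (0 < s.1)%N -> 0 <= u <= 1 ->
  0 <= 2 * u - (takagi_digit s)%:R <= 1 ->
  takagi_gap (takagi_step s) (2 * u - (takagi_digit s)%:R) =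
    2 * takagi_gap s u.
Proof.
case: s => -[//|c] z _ u01; rewrite /takagi_digit /takagi_step /takagi_gap /= ltNge.
case: (c.+2%:R <= 2 * z) => /=; rewrite -[c.+2%:R]natr1 -[c.+1%:R]natr1 => u'01.
  by rewrite [takagi u]takagi_rhalf; [field | lra].
by rewrite mulr0n subr0 in u'01 *; rewrite [takagi u]takagi_lhalf; [field | lra].
Qed.

(** * The level set: forced digits, uniqueness and existence *)

Section LevelSet.
Variables (R : realType) (y : R) (w : nat -> bool).
Hypotheses (y_range : 0 < y < 1 / 2) (y_ndyadic : ~ dyadic_rational y)
  (y_w : binary_expansion y w)
  (w_no000 : ~ exists k l : nat,
     [/\ (1 <= k)%N, (k < l)%N, w k = true
       & [/\ w l = false, w l.+1 = false & w l.+2 = false]]).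

Let st n := takagi_state y n.
Let digit n := takagi_digit (st n).

Let stS n : st n.+1 = takagi_step (st n).
Proof. by []. Qed.

(** Each step doubles z and subtracts an integer; this ties the states to the binary tails of y. *)
Let st_frac n : exists m : nat, (st n).2 = 2 ^+ n.+1 * y - m%:R.
Proof.
elim: n => [|n [m zm]]; first by exists 0%N; rewrite expr1 subr0.
rewrite stS /takagi_step; case: ifP => _ /=; rewrite zm.
  by exists (2 * m)%N; rewrite natrM [2 ^+ n.+2]exprS; ring.
by exists (2 * m + (st n).1.+1)%N; rewrite natrD natrM [2 ^+ n.+2]exprS; ring.
Qed.

(* Stepping down consumes an integer part c + 1 >= 1 of 2z, so a remainder
   at most 1/8 would mean three zeros in the expansion of y after a one. *)
Let digit_gap n : digit n -> (st n).1.+1%:R + 1 / 8 < 2 * (st n).2.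
Proof.
rewrite /digit /takagi_digit; have [m ->] := st_frac n => ge.
have e : 2 * (2 ^+ n.+1 * y - m%:R) = 2 ^+ n.+2 * y - (2 * m)%:R.
  by rewrite [2 ^+ n.+2]exprS natrM; ring.
rewrite e in ge *.
have := @ndyadic_frac_gt8 R y w n.+2 (2 * m + (st n).1.+1) y_ndyadic y_w w_no000.
by rewrite natrD addnS ltn0Sn => /(_ isT); lra.
Qed.

(** z < c excludes a step down from c = 1, which would need z >= 1. The linear bound on c later
    limits the residuals. *)
Let st_bounds n : [/\ (0 < (st n).1)%N, ((st n).1 <= n.+1)%N
  & 0 < (st n).2 < (st n).1%:R].
Proof.
elim: n => [|n [c0 cn zc]]; first by split=> //=; move: y_range; lra.
have gap := @digit_gap n; rewrite /digit /takagi_digit in gap.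
rewrite stS /takagi_step; case: (st n) c0 cn zc gap => -[//|c] z /= _ cn zc gap.
have [lt|ge] /= := ltP (2 * z) c.+2%:R; first by split=> //; lra.
have {}gap := gap ge.
rewrite -[c.+2%:R]natr1 -[c.+1%:R]natr1 in zc gap ge *.
split; [|exact: leq_trans (leqnSn _) (leqW cn)|lra].
by case: (c) gap zc => //=; lra.
Qed.

(** At each step a solution must lie in the half named by the digit, so its orbit stays in [0, 1]
    and keeps solving the current equation. *)
Let level_orbit (u : R) : 0 <= u <= 1 -> takagi_gap (st 0) u = 0 ->
  exists v : nat -> R, [/\ v 0%N = u, forall n, 0 <= v n <= 1
    & forall n, v n.+1 = 2 * v n - (digit n)%:R].
Proof.
move=> u01 gap_u.
pose v := fix v n := if n is n'.+1 then 2 * v n' - (digit n')%:R else u.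
suff v01 n : 0 <= v n <= 1 /\ takagi_gap (st n) (v n) = 0.
  by exists v; split=> // n; case: (v01 n).
elim: n => [//|n [vn01 gap_n]].
have [c0 _ zc] := st_bounds n; have gap := @digit_gap n.
have vS01 : 0 <= v n.+1 <= 1.
  rewrite /=; move: (v n) vn01 gap_n gap => x x01.
  rewrite /digit /takagi_digit /takagi_gap.
  case: (st n) c0 zc => -[//|c] z /= _ zc gap_n gap.
  have c0 : 0 <= c%:R :> R by [].
  have [ge|lt] := leP (c.+2%:R) (2 * z).
    have {}gap := gap ge.
    (* With slope [c.+1], a point of the left half would satisfy T(2x) + (c+2)(2x) = 2z > c + 2 +
       1/8, against [takagi_le_line] once c >= 1; for c = 0, z < 1 already excludes digit 1. *)
    have [xl|] := leP x (1 / 2); last by rewrite mulr1n; lra.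
    case: (posnP c) => [c_eq0|cp].
      by move: zc ge; rewrite c_eq0; lra.
    have x2 : 0 <= 2 * x <= 1 by lra.
    have := @takagi_le_line R c.+2 (2 * x) isT x2.
    have -> : c.+2%:R * (2 * x) = 2 * (c.+1%:R * x) + 2 * x :> R.
      by rewrite -[c.+2%:R]natr1; ring.
    have : 2 ^- c.+2 <= 1 / 8 :> R.
      have -> : 1 / 8 = 2 ^- 3 :> R by rewrite !exprS expr0; field.
      by rewrite lef_pV2 ?posrE ?exprn_gt0 // ler_eXn2l ?ltr1n //; lia.
    by rewrite takagi_lhalf in gap_n; lra.
  rewrite mulr0n subr0.
  have [|xr] := leP x (1 / 2); first by lra.
  (* A point of the right half would give 2z = c + 2 + T(2x - 1) + c(2x - 1) >= c + 2. *)
  have := takagi_ge0 (2 * x - 1).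
  have : 0 <= c%:R * (2 * x - 1) by rewrite mulr_ge0 //; lra.
  rewrite takagi_rhalf in gap_n; last lra.
  by rewrite -[c.+2%:R]natr1 -[c.+1%:R]natr1 in zc lt gap_n; lra.
split=> //; rewrite stS /= takagi_gap_step //.
by rewrite gap_n mulr0.
Qed.

(** Both orbits use the same digits, so their distance doubles at each step yet never exceeds 1. *)
Let level_unique (u1 u2 : R) : 0 <= u1 <= 1 -> 0 <= u2 <= 1 ->
  takagi_gap (st 0) u1 = 0 -> takagi_gap (st 0) u2 = 0 -> u1 = u2.
Proof.
move=> /level_orbit h1 /level_orbit h2 /h1[v1 [<- b1 s1]] /h2[v2 [<- b2 s2]].
apply/eqP; rewrite -subr_eq0; apply/eqP/pow2_scaled_small_eq0 => n.
have -> : 2 ^+ n * `|v1 0%N - v2 0%N| = `|v1 n - v2 n|.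
  elim: n => [|n IH]; first by rewrite expr0 mul1r.
  rewrite exprS -mulrA IH s1 s2 -[2 in LHS]normr_nat -normrM.
  by congr `|_|; ring.
have /andP[? ?] := b1 n; have /andP[? ?] := b2 n.
have : 2 <= n.+2%:R :> R by rewrite ler_nat.
by rewrite ler_norml; lra.
Qed.

(** Let u have the forced digits: its residual doubles at each step but grows at most linearly,
    hence vanishes. *)
Let level_exists : exists2 u : R, 0 <= u <= 1 & takagi_gap (st 0) u = 0.
Proof.
(* Expansions are indexed from 1 and [digit] from 0, hence the shift. *)
have [u u_exp] := @binary_expansion_exists R (fun n => digit n.-1).
have [v [v0 v01 vS]] := binary_expansion_tails u_exp.
exists u; rewrite -v0 //; apply: pow2_scaled_small_eq0 => n.
have -> : 2 ^+ n * `|takagi_gap (st 0) (v 0%N)| = `|takagi_gap (st n) (v n)|.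
  elim: n => [|n IH]; first by rewrite expr0 mul1r.
  have [c0 _ _] := st_bounds n; have vS01 := v01 n.+1.
  rewrite exprS -mulrA IH stS vS /= in vS01 *.
  by rewrite takagi_gap_step // normrM normr_nat.
(* The residual lies between -z > -c and 1 + c, with c <= n + 1. *)
have [_ cn zc] := st_bounds n; have /andP[vn0 vn1] := v01 n.
rewrite -(ler_nat R) in cn; rewrite /takagi_gap -[n.+2%:R]natr1.
have := takagi_ge0 (v n); have := takagi_le1 (v n).
have : 0 <= (st n).1%:R * (v n) by rewrite mulr_ge0.
have : (st n).1%:R * (v n) <= (st n).1%:R by rewrite ler_piMr.
by rewrite ler_norml; lra.
Qed.

Lemma level_set_reflected_pair :
  exists2 x : R, x < 1 / 2 & level_set y = [set x; 1 - x].
Proof.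
have gapE (u : R) : 0 <= u <= 1 -> takagi_gap (st 0) u = 2 * (takagi (u / 2) - y).
  move=> u01; rewrite /takagi_gap /= [takagi (u / 2)]takagi_lhalf; last lra.
  by rewrite mulrCA divff // mulr1; field.
have [u u01 gap_u] := level_exists.
have gap_u' := gap_u; rewrite gapE // in gap_u'.
have Tu : takagi (u / 2) = y by lra.
have half (x : R) : 0 <= x <= 1 / 2 -> takagi x = y -> x = u / 2.
  move=> x01 Tx; suff -> : u = 2 * x by field.
  have x2 : 0 <= 2 * x <= 1 by lra.
  apply: level_unique => //; rewrite gapE //.
  by rewrite [2 * x]mulrC mulfK // Tx subrr mulr0.
exists (u / 2).
  (* u = 1 would give T(1) + 1 = 2y < 1; so x = u/2 and its reflection are distinct. *)
  rewrite ltNge; apply/negP => u1; have u_eq1 : u = 1 by lra.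
  by move: gap_u; rewrite /takagi_gap u_eq1 /=; have := takagi_ge0 (1 : R); move: y_range; lra.
apply/seteqP; split=> x /=.
  move=> [x01 Tx]; have [xl|xr] := leP x (1 / 2).
    by left; apply: half => //; lra.
  right; rewrite -(half (1 - x)) ?takagi_refl //; last lra.
  by ring.
by move=> [->|->]; rewrite /level_set /= ?takagi_refl; split=> //; lra.
Qed.

End LevelSet.

(** * Cardinality of a pair, and the conclusion *)

Lemma card_set_pair (T : choiceType) (a b : T) :
  a != b -> ([set a; b] #= `I_2)%card.
Proof.
move=> ab; apply/pcard_eqP.
suff /Pbij[f] : set_bij [set a; b] `I_2 (fun x => (x != a) : nat) by squash f.
split.
- by move=> x _ /=; case: (_ != a).
- by move=> x1 x2; rewrite !inE => -[->|->] [->|->];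
    rewrite ?eqxx ?(eq_sym b) ?ab.
- move=> [|[|n]] //= _; first by exists a; [left | rewrite eqxx].
  by exists b; [right | rewrite eq_sym ab].
Qed.

Theorem corollary4p2 (R : realType) (y : R) (w : nat -> bool)
  (y_range : 0 < y < 1 / 2)
  (y_ndyadic : ~ dyadic_rational y)
  (y_w : binary_expansion y w)
  (w_no000 : ~ exists k l : nat,
     [/\ (1 <= k)%N, (k < l)%N, w k = true
       & [/\ w l = false, w l.+1 = false & w l.+2 = false]]) :
  (level_set y #= `I_2)%card.
Proof.
have [x x2 ->] := level_set_reflected_pair y_range y_ndyadic y_w w_no000.
by apply: card_set_pair; apply/eqP => e; lra.
Qed.
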